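(* Let $X=\{X(\mathbf{z}),\ \mathbf{z}\in\mathbb{R}^d\}$ be a random field in the Lancaster-Sarmanov class (as defined in the context), with correlation function $\gamma$ satisfying, for some $\varrho\in(0,d)$, $$\gamma(\|\mathbf{x}-\mathbf{y}\|)=\mathcal{O}\left(\|\mathbf{x}-\mathbf{y}\|^{-\varrho}\right)\quad\text{as } \|\mathbf{x}-\mathbf{y}\|\to\infty .$$ Let $\mathcal{S}_{\varrho}(\|\mathbf{x}-\mathbf{y}\|):=I(X(\mathbf{x}),X(\mathbf{y}))$ denote the Shannon mutual information between $X(\mathbf{x})$ and $X(\mathbf{y})$. Then $$\mathcal{S}_{\varrho}(\|\mathbf{x}-\mathbf{y}\|)=\mathcal{O}\left(\|\mathbf{x}-\mathbf{y}\|^{-\varrho}\right)\quad\text{as } \|\mathbf{x}-\mathbf{y}\|\to\infty .$$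
   Context: Lancaster-Sarmanov class: $X=\{X(\mathbf{z}),\ \mathbf{z}\in\mathbb{R}^d\}$ is a real-valued zero-mean, homogeneous and isotropic, mean-square continuous second-order random field on a complete probability space $(\Omega,\mathcal{A},P)$, with correlation function $\gamma(\|\mathbf{x}-\mathbf{y}\|)=\mathrm{Corr}(X(\mathbf{x}),X(\mathbf{y}))$. The marginal distributions are absolutely continuous with (common) probability density $p(u)$ with support included in $(a,b)$, $-\infty\le a<b\le\infty$. $L^2((a,b),p(u)du)$ is the Hilbert space of (classes of) measurable real functions on $(a,b)$ square-integrable with respect to $p(u)du$. It is assumed that there is a complete orthonormal basis $\{e_k,\ k\ge 0\}$ of $L^2((a,b),p(u)du)$, with $e_0\equiv 1$, such that for all $\mathbf{x},\mathbf{y}\in\mathbb{R}^d$ the joint density of $(X(\mathbf{x}),X(\mathbf{y}))$ is $$p(u,v,\|\mathbf{x}-\mathbf{y}\|)=p(u)\,p(v)\left[1+\sum_{k=1}^{\infty}\gamma^k(\|\mathbf{x}-\mathbf{y}\|)\,e_k(u)\,e_k(v)\right],$$ where $\gamma^k$ is the $k$-th power of $\gamma$. Shannon mutual information: $$I(X(\mathbf{x}),X(\mathbf{y}))=\int_a^b\int_a^b p(u,v,\|\mathbf{x}-\mathbf{y}\|)\,\ln\left(\frac{p(u,v,\|\mathbf{x}-\mathbf{y}\|)}{p(u)\,p(v)}\right)du\,dv .$$ By homogeneity and isotropy it depends only on $\|\mathbf{x}-\mathbf{y}\|$. *)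

(* Defs.v *)
From HB Require Import structures.
From mathcomp Require Import all_boot all_order all_algebra.
From mathcomp Require Import all_classical all_reals all_analysis.

Set Implicit Arguments.
Unset Strict Implicit.
Unset Printing Implicit Defensive.

Import Order.TTheory GRing.Theory Num.Theory.
Import numFieldNormedType.Exports.

Local Open Scope classical_set_scope.
Local Open Scope ring_scope.

(* Registers +oo as a bundled filter, as the Landau notation =O_ +oo requires. *)
Canonical pinfty_filter_on (R : realType) : filter_on R :=
  FilterType (pinfty_nbhs R) _.

(* The canonical norm of 'rV[R]_d in the library is the sup norm; isotropy
   refers to the Euclidean one. *)
Definition enorm (R : realType) (d : nat) (x : 'rV[R]_d) : R :=
  Num.sqrt (\sum_(i < d) x ord0 i ^+ 2).

(* The real open interval (a, b), with possibly infinite end points. *)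
Definition oint (R : realType) (a b : \bar R) : set R :=
  [set u | (a < u%:E)%E /\ (u%:E < b)%E].

Definition leb2 (R : realType) :
    {measure set (measurableTypeR R * measurableTypeR R) -> \bar R} :=
  (@lebesgue_measure R \x @lebesgue_measure R)%E.

Definition has_density (disp disp' : measure_display)
    (T : measurableType disp) (U : measurableType disp') (R : realType)
    (P : probability T R) (m : set U -> \bar R) (Y : T -> U) (f : U -> R) :
    Prop :=
  [/\ measurable_fun setT f,
      forall u, 0 <= f u &
      forall A : set U, measurable A ->
        P (Y @^-1` A) = (\int[m]_(u in A) (f u)%:E)%E].

(* Integration over (a, b) against the measure p(u) du. *)
Definition pint (R : realType) (a b : \bar R) (p f : R -> R) : \bar R :=
  (\int[@lebesgue_measure R]_(u in oint a b) (f u * p u)%:E)%E.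

Definition L2_weighted (R : realType) (a b : \bar R) (p f : R -> R) : Prop :=
  measurable_fun (oint a b) f /\ (pint a b p (fun u => f u ^+ 2)%R < +oo)%E.

(* Functions in L^2((a, b), p(u) du) are given by representatives R -> R, whose
   values outside (a, b) are irrelevant. Completeness is the convergence in the
   L^2 norm of all Fourier expansions. *)
Definition complete_orthonormal_basis (R : realType) (a b : \bar R)
    (p : R -> R) (e : nat -> R -> R) : Prop :=
  [/\ forall k, L2_weighted a b p (e k),
      forall j k, pint a b p (fun u => e j u * e k u) = ((j == k)%:R)%:E &
      forall f, L2_weighted a b p f ->
        pint a b p (fun u => (f u - \sum_(0 <= k < n)
          fine (pint a b p (fun v => f v * e k v)) * e k u) ^+ 2)
        @[n --> \oo] --> 0%E].

Section random_field.
Context (disp : measure_display) (T : measurableType disp) (R : realType)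
        (P : probability T R).

Definition correlation (Y Z : {RV P >-> R}) : R :=
  fine (covariance P Y Z) / (Num.sqrt (fine ('V_P[Y])%E) * Num.sqrt (fine ('V_P[Z])%E)).

Context (d : nat) (X : 'rV[R]_d -> {RV P >-> R}).

Definition second_order : Prop := forall x, (X x : T -> R) \in Lfun P 2%:E.

Definition zero_mean : Prop := forall x, ('E_P[X x] = 0)%E.

(* Wide-sense homogeneity and isotropy of a zero-mean field: invariance of the
   covariance under translations, respectively orthogonal transformations. *)
Definition homogeneous : Prop := forall h x y,
  covariance P (X (x + h)) (X (y + h)) = covariance P (X x) (X y).

Definition isotropic : Prop := forall (M : 'M[R]_d) x y, M *m M^T = 1%:M ->
  covariance P (X (x *m M)) (X (y *m M)) = covariance P (X x) (X y).

Definition mean_square_continuous : Prop := forall x,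
  ('E_P[fun t => ((X y t - X x t) ^+ 2)%R])%E @[y --> x] --> 0%E.

End random_field.

(* p(u) p(v) [1 + sum_(1 <= k <= n) g^k e_k(u) e_k(v)] at w = (u, v). *)
Definition lancaster_partial (R : realType) (p : R -> R) (e : nat -> R -> R)
    (g : R) (n : nat) (w : R * R) : R :=
  p w.1 * p w.2 * (1 + \sum_(1 <= k < n.+1) g ^+ k * e k w.1 * e k w.2).

(* q r is the joint density p(., ., r) of two values of the field at distance r.
   Pairs x = y are excluded, since (X x, X x) has no density. The sum of the
   series is understood almost everywhere, as for any formula for a density. *)
Record lancaster_sarmanov (disp : measure_display) (T : measurableType disp)
    (R : realType) (P : probability T R) (d : nat)
    (X : 'rV[R]_d -> {RV P >-> R}) (gamma : R -> R) (a b : \bar R)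
    (p : R -> R) (e : nat -> R -> R) (q : R -> R * R -> R) : Prop := {
  ls_complete : measure_is_complete P ;
  ls_second_order : second_order X ;
  ls_zero_mean : zero_mean X ;
  ls_homogeneous : homogeneous X ;
  ls_isotropic : isotropic X ;
  ls_continuous : mean_square_continuous X ;
  ls_correlation : forall x y, correlation (X x) (X y) = gamma (enorm (x - y)) ;
  ls_interval : (a < b)%E ;
  ls_support : forall u, p u != 0 -> oint a b u ;
  ls_marginal : forall x,
    has_density (U := measurableTypeR R) P (@lebesgue_measure R) (X x) p ;
  ls_basis : complete_orthonormal_basis a b p e ;
  ls_basis0 : forall u, oint a b u -> e 0%N u = 1 ;
  ls_joint : forall x y : 'rV[R]_d, x != y ->
    has_density (U := (measurableTypeR R * measurableTypeR R)%type) P (@leb2 R)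
      (fun t => (X x t, X y t)) (q (enorm (x - y))) ;
  ls_expansion : forall x y : 'rV[R]_d, x != y ->
    {ae @leb2 R, forall w,
       lancaster_partial p e (gamma (enorm (x - y))) n w @[n --> \oo]
         --> q (enorm (x - y)) w}
}.

(* Conventions 0 / 0 = 0 and ln 0 = 0 make the integrand vanish where the joint
   density does. *)
Definition mutual_information (R : realType) (a b : \bar R) (p : R -> R)
    (q : R * R -> R) : \bar R :=
  (\int[@leb2 R]_(w in oint a b `*` oint a b)
     (q w * ln (q w / (p w.1 * p w.2)))%:E)%E.

(* Main.v *)
Require Import Defs.
From HB Require Import structures.
From mathcomp Require Import all_boot all_order all_algebra.
From mathcomp Require Import all_classical all_reals all_analysis.
From mathcomp Require Import measurable_realfun.
From mathcomp Require Import ring lra.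
Import Order.TTheory GRing.Theory Num.Theory.
Import numFieldNormedType.Exports.
Local Open Scope classical_set_scope.
Local Open Scope ring_scope.

(** The mutual information is the relative entropy of the joint density
    [q] with respect to the product [w] of the marginal densities, and a
    relative entropy is at most the chi-square divergence
    [\int (q / w - 1)^2 w].  Indeed, with [h = q / w - 1],
    [q ln (q / w) = (q - w) + w ((1 + h) ln (1 + h) - h)], the first term
    integrates to 0, and the second lies between 0 and [w h^2]
    ([entropy_remainder_bounds]).

    In the Lancaster-Sarmanov class, [h] is the almost everywhere limit of the
    partial sums [\sum_(1 <= k <= n) gamma^k e_k(u) e_k(v)].  Since the [e_k]
    are orthonormal for [p(u) du], these sums have squared norm
    [\sum_(1 <= k <= n) gamma^(2 k)] for [w] ([integral_diagonal_kernel_sq]),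
    so Fatou's lemma bounds the chi-square divergence by the geometric series
    [gamma^2 / (1 - gamma^2)].  This is at most [|gamma|] as soon as
    [|gamma| <= 1/2], which holds at large distances because
    [gamma(r) = O(r^-rho)] tends to 0.  Hence [|S(r)| <= |gamma(r)|] for all
    large [r] ([mutual_information_le]), and the bound on [gamma] is inherited.
*)

(** * Relative entropy and chi-square divergence *)

(** Both bounds come from [ln t <= t - 1]: at [t = 1 + h] for the upper one,
    at [t = (1 + h)^-1] for the lower one.  At [h = - 1] the convention
    [ln 0 = 0] is harmless, being multiplied by 0. *)
Lemma entropy_remainder_bounds (R : realType) (h : R) : - 1 <= h ->
  0 <= (1 + h) * ln (1 + h) - h <= h ^+ 2.
Proof.
rewrite le_eqVlt => /predU1P[<-|h1].
  by rewrite subrr mul0r; lra.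
have h1_gt0 : 0 < 1 + h by lra.
have ln_le : ln (1 + h) <= h by exact: le_ln1Dx.
have ln_ge : h / (1 + h) <= ln (1 + h).
  rewrite -lerN2 -lnV ?posrE// -mulNr.
  have -> : - h / (1 + h) = (1 + h)^-1 - 1 by field; lra.
  rewrite -[X in ln X](subrKC 1); apply: le_ln1Dx.
  by rewrite ltrBDr addNr invr_gt0.
have := ler_wpM2l (ltW h1_gt0) ln_le.
have := ler_wpM2l (ltW h1_gt0) ln_ge.
by rewrite mulrCA divff ?gt_eqF//; nra.
Qed.

Lemma measurable_fun_limn_einf d (T : measurableType d) (R : realType)
    (f : (T -> \bar R)^nat) : (forall n, measurable_fun setT (f n)) ->
  measurable_fun setT (fun x => limn_einf (f ^~ x)).
Proof.
move=> mf; rewrite /limn_einf; apply: measurableT_comp => //.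
by apply: measurable_fun_limn_esup => n; exact: measurableT_comp.
Qed.

Lemma limn_einf_le (R : realType) (u : (\bar R)^nat) (C : \bar R) :
  (forall n, (u n <= C)%E) -> (limn_einf u <= C)%E.
Proof.
move=> uC; rewrite limn_einf_lim; apply: lime_le; first exact: is_cvg_einfs.
apply: nearW => n; apply: le_trans (uC n).
by apply: ereal_inf_lbound; exists n => /=.
Qed.

(** Here [x^-1 = powR x (- 1)] for [0 <= x], including the value
    0 at 0, so that the measurability of powers applies. *)
Lemma measurable_fun_div (d : measure_display) (T : measurableType d)
    (R : realType) (f g : T -> R) :
  (forall x, 0 <= g x) -> measurable_fun setT f -> measurable_fun setT g ->
  measurable_fun setT (fun x => f x / g x).
Proof.
move=> g0 mf mg; apply: measurable_funM => //.
under eq_fun do rewrite -powR_inv1//.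
exact: (measurableT_comp (@measurable_powR R (- 1)) mg).
Qed.

(** The chi-square bound on the relative entropy, for a density [q] known only
    as the almost everywhere limit of [w (1 + h_n)].  The limit of [h_n] exists
    where [w] is positive, while [q] vanishes almost everywhere where [w] does;
    Fatou's lemma applied to [w h_n^2] then replaces any [L^2] convergence of
    [h_n]. *)
Lemma relative_entropy_le (d : measure_display) (T : measurableType d)
    (R : realType) (mu : {measure set T -> \bar R}) (w q : T -> R)
    (h : nat -> T -> R) (C : R) :
  measurable_fun setT w -> (forall x, 0 <= w x) ->
  (\int[mu]_x (w x)%:E = 1)%E ->
  measurable_fun setT q -> (forall x, 0 <= q x) ->
  (\int[mu]_x (q x)%:E = 1)%E ->
  (forall n, measurable_fun setT (h n)) ->
  {ae mu, forall x, w x * (1 + h n x) @[n --> \oo] --> q x} ->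
  (forall n, \int[mu]_x (w x * h n x ^+ 2)%:E <= C%:E)%E ->
  (`| \int[mu]_x (q x * ln (q x / w x))%:E | <= C%:E)%E.
Proof.
move=> mw w0 iw mq q0 iq mh hq hC.
(* [q - w] has integral 0, so [g] has the same integral as the entropy. *)
pose g x := q x * ln (q x / w x) - (q x - w x).
have mg : measurable_fun setT g.
  apply: measurable_funB; last exact: measurable_funB.
  apply: measurable_funM => //.
  by apply: (measurableT_comp (@measurable_ln R)); exact: measurable_fun_div.
have gC : (\int[mu]_x `| (g x)%:E | <= C%:E)%E.
  pose H x := limn_einf (fun n => (w x * h n x ^+ 2)%:E).
  have mwh n : measurable_fun setT (fun x => (w x * h n x ^+ 2)%:E).
    apply/measurable_EFinP; apply: measurable_funM => //.
    exact: measurable_funX.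
  have wh0 n x : (0 <= (w x * h n x ^+ 2)%:E)%E.
    by rewrite lee_fin mulr_ge0// sqr_ge0.
  apply: (@le_trans _ _ (\int[mu]_x H x)%E).
    apply: ae_ge0_le_integral => //.
    - apply: measurableT_comp => //; exact/measurable_EFinP.
    - move=> x _; rewrite /H limn_einf_lim; apply: lime_ge.
        exact: is_cvg_einfs.
      by apply: nearW => n; apply: le_ereal_inf_tmp => _ [m _ <-].
    - exact: measurable_fun_limn_einf.
    apply: filterS hq => x hqx _.
    (* Where [w] vanishes, the convergence forces [q = 0], hence [g = 0]. *)
    have [wx0|wx0] := eqVneq (w x) 0.
      have qx0 : q x = 0.
        apply/esym; move: hqx; under eq_fun do rewrite wx0 mul0r.
        by move/(cvg_unique _ (cvg_cst 0)); apply; exact: Rhausdorff.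
      have -> : H x = limn_einf (cst 0%E).
        by rewrite /H; congr limn_einf; apply/funext => n; rewrite wx0 mul0r.
      rewrite (cvg_limn_einf_sup (cvg_cst _)).1.
      by rewrite /g qx0 wx0 mul0r subrr subrr/= normr0.
    pose r := q x / w x - 1.
    have wx_gt0 : 0 < w x by rewrite lt_neqAle eq_sym wx0 w0.
    have qE : q x = w x * (1 + r) by rewrite /r; field.
    have hr : h n x @[n --> \oo] --> r.
      have -> : (fun n => h n x) = (fun n => w x * (1 + h n x) / w x - 1).
        by apply/funext => n; field.
      by apply: cvgB; [apply: cvgMl | apply: cvg_cst].
    have -> : H x = (w x * r ^+ 2)%:E.
      apply: (cvg_limn_einf_sup _).1; apply: cvg_EFin; first exact: nearW.
      by apply: cvgMr; apply: cvgM.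
    have r1 : - 1 <= r by rewrite /r; have := divr_ge0 (q0 x) (w0 x); lra.
    have -> : g x = w x * ((1 + r) * ln (1 + r) - r).
      rewrite /g; have -> : q x / w x = 1 + r by rewrite /r; ring.
      by rewrite qE; ring.
    have /andP[b1 b2] := @entropy_remainder_bounds _ _ r1.
    by rewrite /= lee_fin ger0_norm ?mulr_ge0// ler_wpM2l.
  apply: le_trans (fatou _ _ _ _) _ => //.
  by apply: limn_einf_le.
have gi : mu.-integrable setT (EFin \o g).
  apply/integrableP; split; first exact/measurable_EFinP.
  exact: le_lt_trans gC (ltry _).
have qi : mu.-integrable setT (EFin \o q).
  apply/integrableP; split; first exact/measurable_EFinP.
  by under eq_integral do rewrite /= ger0_norm//; rewrite iq ltry.
have wi : mu.-integrable setT (EFin \o w).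
  apply/integrableP; split; first exact/measurable_EFinP.
  by under eq_integral do rewrite /= ger0_norm//; rewrite iw ltry.
suff -> : (\int[mu]_x (q x * ln (q x / w x))%:E = \int[mu]_x (g x)%:E)%E.
  apply: le_trans gC; apply: le_abse_integral => //; exact/measurable_EFinP.
under eq_integral => x _.
  rewrite (_ : _%:E =
    (EFin \o g) x + ((EFin \o q) x - (EFin \o w) x))%E; last first.
    by rewrite /= -EFinB -EFinD /g; congr EFin; ring.
  over.
rewrite integralD//; last by apply: integrableB.
by rewrite integralB// iq iw subee// adde0.
Qed.

(** * Partial sums of the Lancaster expansion *)

Lemma integrable_tensor (d1 d2 : measure_display)
    (T1 : measurableType d1) (T2 : measurableType d2)
    (R : realType) (m1 : {sigma_finite_measure set T1 -> \bar R})
    (m2 : {sigma_finite_measure set T2 -> \bar R}) (f : T1 -> R) (g : T2 -> R) :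
  m1.-integrable setT (EFin \o f) -> m2.-integrable setT (EFin \o g) ->
  (m1 \x m2)%E.-integrable setT (fun z => (f z.1 * g z.2)%:E).
Proof.
move=> fi gi.
have mf : measurable_fun setT f by apply/measurable_EFinP; case/integrableP: fi.
have mg : measurable_fun setT g by apply/measurable_EFinP; case/integrableP: gi.
apply/integrable12ltyP.
  apply/measurable_EFinP; apply: measurable_funM.
    exact: (measurableT_comp mf measurable_fst).
  exact: (measurableT_comp mg measurable_snd).
have [_ ifoo] := integrableP _ _ _ fi.
have [mgE igoo] := integrableP _ _ _ gi.
under eq_integral => x _.
  under eq_integral => y _.
    rewrite /= normrM EFinM.
  over.
  rewrite ge0_integralZl//; last first.
    by apply/measurable_EFinP; exact: measurableT_comp.
  over.
rewrite /= ge0_integralZr//.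
- apply: lte_mul_pinfty => //; first exact: integral_ge0.
  by rewrite ge0_fin_numE//; exact: integral_ge0.
- by apply/measurable_EFinP; exact: measurableT_comp.
- exact: integral_ge0.
Qed.

Lemma integral_tensor (d1 d2 : measure_display)
    (T1 : measurableType d1) (T2 : measurableType d2)
    (R : realType) (m1 : {sigma_finite_measure set T1 -> \bar R})
    (m2 : {sigma_finite_measure set T2 -> \bar R}) (f : T1 -> R) (g : T2 -> R) :
  m1.-integrable setT (EFin \o f) -> m2.-integrable setT (EFin \o g) ->
  (\int[m1 \x m2]_z (f z.1 * g z.2)%:E =
   (\int[m1]_x (f x)%:E) * (\int[m2]_y (g y)%:E))%E.
Proof.
move=> fi gi; rewrite -integral12_prod_meas1; last exact: integrable_tensor.
rewrite /fubini_F.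
under eq_integral => x _.
  under eq_integral do rewrite /= EFinM.
  rewrite integralZl//.
  rewrite -[X in (_ * X)%E]fineK; last exact: integrable_fin_num.
  over.
rewrite /= integralZr//; congr (_ * _)%E; rewrite fineK//.
exact: integrable_fin_num.
Qed.

(** Parseval's identity for the functions [e_k(u) e_k(v)], which are orthonormal
    in [L^2(p(u) p(v) du dv)] when the [e_k] are in [L^2(p(u) du)]. *)
Lemma integral_diagonal_kernel_sq (d : measure_display) (T : measurableType d)
    (R : realType) (mu : {sigma_finite_measure set T -> \bar R}) (p : T -> R)
    (e : nat -> T -> R) (g : R) (r : seq nat) :
  uniq r ->
  (forall j k, mu.-integrable setT (EFin \o (fun u => e j u * e k u * p u))) ->
  (forall j k, \int[mu]_u (e j u * e k u * p u)%:E = ((j == k)%:R)%:E)%E ->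
  (\int[mu \x mu]_z
     (p z.1 * p z.2 * (\sum_(k <- r) g ^+ k * e k z.1 * e k z.2) ^+ 2)%:E =
   (\sum_(k <- r) (g ^+ 2) ^+ k)%:E)%E.
Proof.
move=> ur ei eo.
pose f j k u := e j u * e k u * p u.
have fE j k : (\int[mu \x mu]_z (f j k z.1 * f j k z.2)%:E =
    ((j == k)%:R)%:E)%E.
  by rewrite integral_tensor ?eo -?EFinM -?natrM ?mulnb ?andbb//; exact: ei.
have ti j k : (mu \x mu)%E.-integrable setT
    (fun z => (f j k z.1 * f j k z.2)%:E).
  by apply: integrable_tensor; exact: ei.
have fi j k : (mu \x mu)%E.-integrable setT
    (fun z => (g ^+ (j + k))%:E * (f j k z.1 * f j k z.2)%:E)%E.
  by apply: integrableZl => //; exact: ti.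
under eq_integral => z _.
  rewrite (_ : _%:E = \sum_(j <- r) \sum_(k <- r)
      (g ^+ (j + k))%:E * (f j k z.1 * f j k z.2)%:E)%E; last first.
    rewrite expr2 big_distrlr/= mulr_sumr -sumEFin; apply: eq_bigr => j _.
    rewrite mulr_sumr -sumEFin; apply: eq_bigr => k _.
    by rewrite -EFinM /f exprD; congr EFin; ring.
  over.
rewrite integral_sum//; last by move=> j; exact: integrable_sum.
rewrite -sumEFin [LHS]big_seq [RHS]big_seq; apply: eq_bigr => j jr.
rewrite integral_sum// (bigD1_seq j)//= big1 ?adde0 => [|k kj].
  by rewrite integralZl// fE eqxx mule1 -exprM mul2n addnn.
by rewrite integralZl// fE eq_sym (negbTE kj) mule0.
Qed.

(** The series is at most [g^2 / (1 - g^2) <= 2 g^2 <= |g|]; weakening [g^2] to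
    [|g|] costs nothing, since only a bound of order [|g|] is sought. *)
Lemma sum_geometric_le (R : realType) (g : R) (n : nat) : `|g| <= 2^-1 ->
  \sum_(1 <= k < n.+1) (g ^+ 2) ^+ k <= `|g|.
Proof.
move=> g2; set s := g ^+ 2.
have s0 : 0 <= s by exact: sqr_ge0.
have sE : s = `|g| * `|g| by rewrite -normrM ger0_norm -expr2.
have g0 := normr_ge0 g.
have telescope : (1 - s) * \sum_(1 <= k < n.+1) s ^+ k = s - s ^+ n.+1.
  elim: n => [|n IHn]; first by rewrite big_geq// mulr0 expr1 subrr.
  by rewrite big_nat_recr//= mulrDr IHn [s ^+ n.+2]exprS; ring.
have s_le : s <= 2^-1 * `|g| by rewrite sE ler_wpM2r.
rewrite -(@ler_pM2l _ (1 - s)); last by lra.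
rewrite telescope; have := exprn_ge0 n.+1 s0; nra.
Qed.

Lemma measurable_oint (R : realType) (a b : \bar R) :
  measurable (oint a b : set (measurableTypeR R)).
Proof.
have -> : oint a b = setT `&` EFin @^-1` [set` `]a, b[%R].
  rewrite setTI; apply/seteqP; split => u /=; rewrite in_itv/=.
    by move=> [-> ->].
  by move=> /andP[].
by apply: EFin_measurable => //; exact: emeasurable_itv.
Qed.

(** * Mutual information in the Lancaster-Sarmanov class *)

Section lancaster.
Context (disp : measure_display) (T : measurableType disp)
    (R : realType) (P : probability T R) (d : nat)
    (X : 'rV[R]_d -> {RV P >-> R}) (gamma : R -> R) (a b : \bar R)
    (p : R -> R) (e : nat -> R -> R) (q : R -> R * R -> R)
    (hX : lancaster_sarmanov X gamma a b p e q).

Let leb := @lebesgue_measure R.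

(** [e k] is measurable only on [(a, b)]; truncating it outside makes it
    measurable on the line without changing its products with [p]. *)
Let E k : measurableTypeR R -> R := (e k) \_ (oint a b).

Let p_out u : u \notin oint a b -> p u = 0.
Proof.
move=> /negP uD; apply/eqP/negPn/negP => /(ls_support hX) ?.
by apply: uD; rewrite inE.
Qed.

Let measurable_E k : measurable_fun setT (E k).
Proof.
apply/(@measurable_restrictT _ _ _ _ _ _ (@measurable_oint R a b)).
by have [eL _ _] := ls_basis hX; case: (eL k).
Qed.

Let integral_EE j k :
  (\int[leb]_u (E j u * E k u * p u)%:E = ((j == k)%:R)%:E)%E.
Proof.
have [_ <- _] := ls_basis hX.
rewrite /pint [RHS]integral_mkcond; apply: eq_integral => u _.
rewrite /E !patchE; case: ifPn => // _.
by rewrite !mul0r.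
Qed.

Let p_ge0 u : 0 <= p u.
Proof. by have [_ +_] := ls_marginal hX 0; apply. Qed.

Let measurable_p : measurable_fun (setT : set (measurableTypeR R)) p.
Proof. by have [] := ls_marginal hX 0. Qed.

Let integral_p : (\int[leb]_u (p u)%:E = 1)%E.
Proof.
have [_ _ /(_ setT measurableT)] := ls_marginal hX 0.
by rewrite preimage_setT probability_setT.
Qed.

Let integrable_p : leb.-integrable setT (EFin \o p).
Proof.
apply/integrableP; split; first exact/measurable_EFinP.
by under eq_integral do rewrite /= ger0_norm//; rewrite integral_p ltry.
Qed.

(** [|e_j e_k| <= e_j^2 + e_k^2], and the squares are integrable since they have
    integral 1. *)
Let integrable_EE j k :
  leb.-integrable setT (EFin \o (fun u => E j u * E k u * p u)).
Proof.
have mEE i l : measurable_fun setT (EFin \o (fun u => E i u * E l u * p u)).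
  apply/measurable_EFinP; apply: measurable_funM => //.
  exact: measurable_funM.
have sq i : leb.-integrable setT (EFin \o (fun u => E i u * E i u * p u)).
  apply/integrableP; split => //.
  under eq_integral => u _.
    rewrite /= ger0_norm; last by rewrite mulr_ge0// -expr2 sqr_ge0.
    over.
  by rewrite integral_EE ltry.
apply: (le_integrable _ _ _ (integrableD _ (sq j) (sq k))) => // u _ /=.
have ? := p_ge0 u.
rewrite lee_fin -mulrDl !normrM ler_wpM2r//.
rewrite -normrM ler_norml; apply/andP.
have -> : `|E j u * E j u + E k u * E k u| = E j u * E j u + E k u * E k u.
  by rewrite ger0_norm// addr_ge0// -expr2 sqr_ge0.
split; nra.
Qed.

(** An instance of [relative_entropy_le] on the whole plane: outside the square
    of [(a, b)] the product density is 0, so the integrand is 0 there by the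
    conventions [0^-1 = 0] and [ln 0 = 0]. *)
Lemma mutual_information_le (x y : 'rV[R]_d) : x != y ->
  `| gamma (enorm (x - y)) | <= 2^-1 ->
  (`| mutual_information a b p (q (enorm (x - y))) | <=
   `| gamma (enorm (x - y)) |%:E)%E.
Proof.
move=> xy; have [mq q0 iq] := ls_joint hX xy.
have hq := ls_expansion hX xy.
move: (gamma _) (q _) mq q0 iq hq => g f mf f0 intf hf g2.
pose w (z : measurableTypeR R * measurableTypeR R) := p z.1 * p z.2.
pose h n (z : measurableTypeR R * measurableTypeR R) :=
  \sum_(1 <= k < n.+1) g ^+ k * E k z.1 * E k z.2.
have -> : mutual_information a b p f =
    (\int[@leb2 R]_z (f z * ln (f z / w z))%:E)%E.
  rewrite /mutual_information integral_mkcond; apply: eq_integral => z _.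
  rewrite patchE; case: ifPn => // zD.
  have -> : w z = 0.
    move: zD; rewrite /w notin_setE => zD.
    have [z1|/p_out->] := boolP (z.1 \in oint a b); last by rewrite mul0r.
    have [z2|/p_out->] := boolP (z.2 \in oint a b); last by rewrite mulr0.
    by case: zD; move: z1 z2; rewrite !inE.
  by rewrite invr0 mulr0 ln0// mulr0.
have mfst := measurableT_comp measurable_p (@measurable_fst _ _ _ _).
have msnd := measurableT_comp measurable_p (@measurable_snd _ _ _ _).
apply: (relative_entropy_le _ _ _ _ _ _ h).
- by apply: measurable_funM; [exact: mfst|exact: msnd].
- by move=> z; rewrite mulr_ge0.
- by rewrite /leb2 integral_tensor// integral_p mule1.
- exact: mf.
- exact: f0.
- by move: (intf _ measurableT); rewrite preimage_setT probability_setT.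
- move=> n; apply: measurable_sum => k; apply: measurable_funM.
    apply: measurable_funM => //.
    exact: (measurableT_comp (measurable_E k) measurable_fst).
  exact: (measurableT_comp (measurable_E k) measurable_snd).
- apply: (@filterS _ _ (ae_filter_ringOfSetsType (leb2 R)) _ _ _ hf) => z.
  apply: cvg_trans.
  rewrite (_ : (fun n => _) = (fun n => lancaster_partial p e g n z)) //.
  apply/funext => n; rewrite /lancaster_partial /w /h /E.
  have [z1|/p_out->] := boolP (z.1 \in oint a b); last by rewrite !mul0r.
  have [z2|/p_out->] := boolP (z.2 \in oint a b); last by rewrite mulr0 !mul0r.
  congr (_ * (1 + _)); apply: eq_bigr => k _.
  by rewrite !patchE z1 z2.
- move=> n; rewrite /leb2 integral_diagonal_kernel_sq ?iota_uniq//.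
  by rewrite lee_fin sum_geometric_le.
Qed.

End lancaster.

(** * Decay at large distances *)

(** In positive dimension every positive number is the distance of two distinct
    points, so the values of [S] near infinity are all mutual informations. *)
Lemma exists_enorm (R : realType) (d : nat) (r : R) : (0 < d)%N -> 0 < r ->
  exists2 x : 'rV[R]_d, x != 0 & enorm (x - 0) = r.
Proof.
case: d => // d _ r0; pose x : 'rV[R]_d.+1 := r *: delta_mx 0 0.
have xr : enorm (x - 0) = r.
  rewrite subr0 /enorm big_ord_recl big1 => [|i _].
    by rewrite addr0 !mxE !eqxx mulr1 sqrtr_sqr gtr0_norm.
  by rewrite !mxE/= mulr0 expr0n.
exists x => //; apply: contra_eq_neq xr => ->.
by rewrite subr0 /enorm big1 => [|i _]; rewrite ?mxE ?expr0n// sqrtr0 lt_eqF.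
Qed.

Lemma near_pinfty_powRN_le (R : realType) (rho c : R) : 0 < rho -> 0 < c ->
  \forall r \near +oo, r `^ (- rho) <= c.
Proof.
move=> rho0 c0; near=> r.
(* This threshold solves [r^rho = c^-1]. *)
have rM : c^-1 `^ rho^-1 <= r by near: r; exact: nbhs_pinfty_ge.
have cV0 : 0 < c^-1 by rewrite invr_gt0.
have : (c^-1 `^ rho^-1) `^ rho <= r `^ rho.
  apply: ge0_ler_powR => //; first exact: ltW.
    by rewrite nnegrE powR_ge0.
  by rewrite nnegrE (le_trans _ rM)// powR_ge0.
rewrite -powRrM mulVf ?gt_eqF// powRr1; last exact: ltW.
move=> cr; rewrite powRN -[leRHS]invrK lef_pV2 ?posrE//.
exact: lt_le_trans cr.
Unshelve. all: by end_near. Qed.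

Theorem lemma1 (disp : measure_display) (T : measurableType disp)
    (R : realType) (P : probability T R) (d : nat)
    (X : 'rV[R]_d -> {RV P >-> R}) (gamma : R -> R) (a b : \bar R)
    (p : R -> R) (e : nat -> R -> R) (q : R -> R * R -> R)
    (hX : lancaster_sarmanov X gamma a b p e q)
    (rho : R) (hrho : 0 < rho < d%:R)
    (hgamma : gamma =O_ +oo (fun r : R => r `^ (- rho)))
    (S : R -> \bar R)
    (hS : forall x y : 'rV[R]_d, x != y ->
       S (enorm (x - y)) = mutual_information a b p (q (enorm (x - y)))) :
  (\forall r \near +oo, S r \is a fin_num) /\
  (fun r : R => fine (S r)) =O_ +oo (fun r : R => r `^ (- rho)).
Proof.
have /andP[rho0 rhod] := hrho.
have d0 : (0 < d)%N by rewrite -(ltr0n R); exact: lt_trans rhod.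
have /eqO_exP[k k0 gk] := hgamma.
have gamma_small : \forall r \near +oo, `|gamma r| <= 2^-1.
  near=> r; have /le_trans -> // : `|gamma r| <= k * `|r `^ (- rho)|.
    by near: r.
  rewrite ger0_norm ?powR_ge0// -ler_pdivlMl//.
  by near: r; apply: near_pinfty_powRN_le => //; rewrite mulr_gt0 ?invr_gt0.
have S_le : \forall r \near +oo, (`| S r | <= `|gamma r|%:E)%E.
  near=> r.
  have r0 : 0 < r by near: r; exact: nbhs_pinfty_gt.
  have [x x0 xr] := exists_enorm R d r d0 r0.
  rewrite -xr hS//; apply: (mutual_information_le _ _ _ _ _ _ _ _ _ _ _ _ hX) => //.
  by rewrite xr; near: r.
have S_fin : \forall r \near +oo, S r \is a fin_num.
  apply: filterS S_le => r Sr; rewrite fin_num_abs.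
  exact: le_lt_trans Sr (ltry _).
split => //; apply/eqO_exP; exists k => //; near=> r.
apply: (@le_trans _ _ `|gamma r|); last by near: r.
rewrite -lee_fin -abse_EFin fineK; first by near: r.
by near: r.
Unshelve. all: by end_near. Qed.
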